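(* Let $H$ be a linear hypergraph of order $n$ with hyperedges $E_1,\ldots,E_m$ such that $|S_i^{(1)}|\ge 2$ for all $1\le i\le m$, where $S_i^{(1)}$ is the set of vertices of degree one contained in $E_i$. Let $\pi$ be the packing number of $H$. Then $\lambda(H)\le n-\pi$, and this bound is sharp, i.e. there exist such hypergraphs for which equality holds.
   Context: A hypergraph $H$ is a pair $(V(H),E(H))$ with $V(H)$ a finite set and $E(H)$ a finite family of non-empty subsets of $V(H)$ (hyperedges) whose union is $V(H)$. Standing assumption: all hypergraphs are connected (any two vertices are joined by a path $v,E_1,w_1,E_2,\ldots,w_{l-1},E_l,u$ with $v\in E_1$, $w_i\in E_i\cap E_{i+1}$, $u\in E_l$) and Sperner (no hyperedge is a subset of another hyperedge). $H$ is linear if $|E_i\cap E_j|\le 1$ for distinct hyperedges $E_i,E_j$. The degree of a vertex is the number of hyperedges containing it; the order of $H$ is $|V(H)|$. A vertex packing is a set $\mathcal{P}\subseteq V(H)$ no two elements of which belong to the same hyperedge; the packing number $\pi$ is the maximum cardinality of a vertex packing. For a vertex $u$, $N(u)$ is the set of vertices $v\ne u$ such that some hyperedge contains both $u$ and $v$. A set $S\subseteq V(H)$ is locating-dominating if for any two distinct $u,v\in V(H)-S$, $N(u)\cap S\neq N(v)\cap S$, and $N(u)\cap S\ne\emptyset$ for every $u\in V(H)-S$. $\lambda(H)$ is the minimum cardinality of a locating-dominating set of $H$. *)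

(* Defs.v *)
From mathcomp Require Import all_boot.

Set Implicit Arguments.
Unset Strict Implicit.
Unset Printing Implicit Defensive.

(* A set of hyperedges suffices to represent the family: a repeated hyperedge
   would be contained in its copy, which the Sperner condition forbids. *)
Record hypergraph := Hypergraph {
  vertex : finType;
  edges : {set {set vertex}};
  edges_nonempty : set0 \notin edges;
  edges_cover : cover edges = [set: vertex] }.

Section HypergraphNotions.
Variable H : hypergraph.
Implicit Types (u v : vertex H) (e f : {set vertex H}) (S P : {set vertex H}).

Definition hypergraph_order := #|vertex H|.

Definition sperner :=
  {in edges H &, forall e f, e != f -> ~~ (e \subset f)}.

(* The hyperedges of the path are e :: s; consecutive ones share some w_i. *)
Definition connected :=
  forall u v, exists e (s : seq {set vertex H}),
    [/\ {subset e :: s <= edges H},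
        u \in e,
        path (fun f g => f :&: g != set0) e s &
        v \in last e s].

Definition linear :=
  {in edges H &, forall e f, e != f -> #|e :&: f| <= 1}.

Definition degree u := #|[set e in edges H | u \in e]|.

Definition degree_one_part e := [set u in e | degree u == 1].

Definition same_edge u v := [exists e in edges H, (u \in e) && (v \in e)].

Definition vertex_packing P :=
  [forall u in P, forall v in P, (u != v) ==> ~~ same_edge u v].

Definition packing_number := \max_(P : {set vertex H} | vertex_packing P) #|P|.

Definition neighborhood u := [set v | (v != u) && same_edge u v].

Definition locating_dominating S :=
  [forall u in ~: S, forall v in ~: S,
     (u != v) ==> (neighborhood u :&: S != neighborhood v :&: S)]
  && [forall u in ~: S, neighborhood u :&: S != set0].

(* [set: vertex H] is always locating-dominating, so this is a true minimum. *)
Definition location_domination_number :=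
  #|[arg min_(S < [set: vertex H] | locating_dominating S) #|S| ]|.

End HypergraphNotions.

(* Main.v *)
Require Import Defs.
From mathcomp Require Import all_boot.

(** The bound holds because a packing can be pushed onto degree-one vertices
    without changing its size: each packed vertex u is replaced by a degree-one
    vertex x u of some edge E u through u.  Distinct packed vertices lie in
    distinct edges E u, and x u lies in no other edge than E u, so x is
    injective on the packing.  The edge E u has a second degree-one vertex y u,
    which stays outside the image of x.  It is a neighbour of x u and of no
    other x v, hence it both dominates x u and separates it from the rest of
    the image.  The complement of the image is therefore locating-dominating
    (lemma [packing_witnesses_locating]); applied to a maximum packing, this is
    the bound.

    Equality holds already for a single edge with two vertices: one vertex is a
    packing, so the bound is at most 1, while a locating-dominating set of a
    hypergraph with a vertex cannot be empty. *)

Lemma in_some_edge (H : hypergraph) (u : vertex H) :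
  exists2 e, e \in edges H & u \in e.
Proof.
have : u \in cover (edges H) by rewrite edges_cover inE.
by move=> /bigcupP[e eH ue]; exists e.
Qed.

Lemma degree_one_edge_uniq (H : hypergraph) (u : vertex H) e f :
    degree u == 1 -> e \in edges H -> f \in edges H -> u \in e -> u \in f ->
  e = f.
Proof.
move=> /cards1P[g gP] eH fH ue uf.
have : e \in [set g] by rewrite -gP inE eH.
have : f \in [set g] by rewrite -gP inE fH.
by rewrite !inE => /eqP-> /eqP->.
Qed.

Lemma same_edgeP (H : hypergraph) (u v : vertex H) :
  reflect (exists2 e, e \in edges H & (u \in e) && (v \in e)) (same_edge u v).
Proof. exact: exists_inP. Qed.

Lemma packing_same_edge_eq (H : hypergraph) (P : {set vertex H}) u v :
  vertex_packing P -> u \in P -> v \in P -> same_edge u v -> u = v.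
Proof.
move=> /forall_inP/(_ u) packP uP vP uv; apply/eqP/negPn/negP => neq_uv.
by have /forall_inP/(_ v vP)/implyP/(_ neq_uv) := packP uP; rewrite uv.
Qed.

Lemma location_domination_number_le (H : hypergraph) (S : {set vertex H}) :
  locating_dominating S -> location_domination_number H <= #|S|.
Proof.
move=> ldS; rewrite /location_domination_number; case: arg_minnP; last first.
  by move=> T _; apply.
by rewrite /locating_dominating setCT; apply/andP; split;
  apply/forall_inP => u; rewrite inE.
Qed.

Lemma location_domination_number_gt0 (H : hypergraph) (u : vertex H) :
  0 < location_domination_number H.
Proof.
rewrite /location_domination_number; case: arg_minnP => [|S /andP[_ domS] _].
  by rewrite /locating_dominating setCT; apply/andP; split;
    apply/forall_inP => v; rewrite inE.
rewrite card_gt0; apply/negP => /eqP S0.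
by move/forall_inP/(_ u): domS; rewrite S0 setC0 setI0 eqxx inE => /(_ isT).
Qed.

(** The vertex y u lies in no edge but E u, so among the vertices x v it is
    adjacent to x u alone and tells it apart from the others.  The set P merely
    indexes the edges, so injectivity of E on P stands in for the packing
    condition. *)
Lemma packing_witnesses_locating (H : hypergraph) (P : {set vertex H})
    (E : vertex H -> {set vertex H}) (x y : vertex H -> vertex H) :
    (forall u, E u \in edges H) -> {in P &, injective E} ->
    (forall u, x u \in degree_one_part (E u)) ->
    (forall u, y u \in degree_one_part (E u)) -> (forall u, x u != y u) ->
  locating_dominating (~: (x @: P)).
Proof.
move=> EH injE xE yE neq_xy.
have yS u : u \in P -> y u \in ~: (x @: P).
  move=> uP; rewrite inE; apply/imsetP => -[v vP yx].
  have [/setIdP[yEu y1] /setIdP[xEv _]] := (yE u, xE v).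
  have uv : u = v.
    apply: injE => //.
    by apply: (degree_one_edge_uniq _ _ _ _ y1) => //; rewrite yx.
  by move: (neq_xy u); rewrite yx uv eqxx.
have yN u : y u \in neighborhood (x u).
  have [/setIdP[yEu _] /setIdP[xEu _]] := (yE u, xE u).
  rewrite inE eq_sym neq_xy; apply/same_edgeP.
  by exists (E u); rewrite ?xEu.
have yN_eq u v : u \in P -> v \in P -> y u \in neighborhood (x v) -> u = v.
  move=> uP vP; rewrite inE => /andP[_ /same_edgeP[e eH /andP[xe ye]]].
  have [/setIdP[yEu y1] /setIdP[xEv x1]] := (yE u, xE v).
  apply: injE => //.
  rewrite (degree_one_edge_uniq _ _ _ _ y1 (EH u) eH yEu ye).
  exact: (degree_one_edge_uniq _ _ _ _ x1 eH (EH v)).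
rewrite /locating_dominating setCK; apply/andP; split; last first.
  apply/forall_inP => _ /imsetP[u uP ->]; apply/set0Pn; exists (y u).
  by rewrite in_setI yN yS.
apply/forall_inP => _ /imsetP[u uP ->]; apply/forall_inP => _ /imsetP[v vP ->].
apply/implyP; apply: contraNneq => /setP/(_ (y u)).
by rewrite !in_setI yN yS // !andbT => /esym/yN_eq->.
Qed.

Lemma location_domination_le_packing (H : hypergraph) (P : {set vertex H}) :
    (forall e, e \in edges H -> 2 <= #|degree_one_part e|) ->
    vertex_packing P ->
  location_domination_number H <= hypergraph_order H - #|P|.
Proof.
move=> deg1 packP.
have witness u : exists t : {set vertex H} * (vertex H * vertex H),
    [&& t.1 \in edges H, u \in t.1, t.2.1 \in degree_one_part t.1,
        t.2.2 \in degree_one_part t.1 & t.2.1 != t.2.2].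
  have [e eH ue] := in_some_edge _ u.
  have /card_gt1P[a [b [aE bE neq_ab]]] := deg1 e eH.
  by exists (e, (a, b)); apply/and5P.
pose t u := xchoose (witness u).
pose E u := (t u).1; pose x u := (t u).2.1; pose y u := (t u).2.2.
have tP u : [/\ E u \in edges H, u \in E u, x u \in degree_one_part (E u),
    y u \in degree_one_part (E u) & x u != y u].
  exact/and5P/(xchooseP (witness u)).
have injE : {in P &, injective E}.
  move=> u v uP vP Euv; apply: (packing_same_edge_eq _ _ _ _ packP) => //.
  have [[EH uE _ _ _] [_ vE _ _ _]] := (tP u, tP v).
  by apply/same_edgeP; exists (E u); rewrite // uE Euv.
have injx : {in P &, injective x}.
  move=> u v uP vP xuv; apply: injE => //.
  have [[EuH _ /setIdP[xEu x1] _ _] [EvH _ /setIdP[xEv _] _ _]] := (tP u, tP v).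
  by apply: (degree_one_edge_uniq _ _ _ _ x1) => //; rewrite xuv.
rewrite -(card_in_imset injx) /hypergraph_order -(setCK (x @: P)) -cardsCs.
apply: location_domination_number_le.
by apply: (packing_witnesses_locating _ P E x y) => // u; case: (tP u).
Qed.

Lemma packing_number_witness (H : hypergraph) :
  exists2 P : {set vertex H}, vertex_packing P & packing_number H = #|P|.
Proof.
have [|P packP eqP] := @eq_bigmax_cond _ (@vertex_packing H)
  (fun P : {set vertex H} => #|P|); last by exists P.
apply/card_gt0P; exists set0; rewrite unfold_in.
by apply/forall_inP => u; rewrite inE.
Qed.

Lemma location_domination_bound (H : hypergraph) :
    (forall e, e \in edges H -> 2 <= #|degree_one_part e|) ->
  location_domination_number H <= hypergraph_order H - packing_number H.
Proof.
move=> deg1; have [P packP ->] := packing_number_witness H.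
exact: location_domination_le_packing.
Qed.

Fact one_edge_nonempty : set0 \notin [set [set: bool]].
Proof. by rewrite inE; apply/eqP => /setP/(_ true); rewrite !inE. Qed.

Definition one_edge : hypergraph :=
  Hypergraph one_edge_nonempty (cover1 [set: bool]).

Lemma one_edge_degree (u : vertex one_edge) : degree u = 1.
Proof.
rewrite /degree -(cards1 [set: bool]); congr #|pred_of_set _|.
by apply/setP => e; rewrite !inE; case: eqP => // ->; rewrite inE.
Qed.

Lemma one_edge_degree_one_part e :
  e \in edges one_edge -> 2 <= #|degree_one_part e|.
Proof.
rewrite inE => /eqP->; apply/card_gt1P; exists true, false.
by rewrite !inE !one_edge_degree.
Qed.

Lemma one_edge_packing_number_gt0 : 0 < packing_number one_edge.
Proof.
rewrite /packing_number (bigD1 [set true]) /=; first by rewrite cards1 leq_max.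
apply/forall_inP => u /set1P->; apply/forall_inP => v /set1P->.
by rewrite eqxx.
Qed.

Theorem theorem2p12 :
  (forall H : hypergraph,
     connected H -> sperner H -> linear H ->
     (forall e : {set vertex H},
        e \in edges H -> 2 <= #|degree_one_part e|) ->
     location_domination_number H <= hypergraph_order H - packing_number H)
  /\
  (exists H : hypergraph,
     [/\ connected H, sperner H, linear H & 0 < #|edges H|] /\
     (forall e : {set vertex H},
        e \in edges H -> 2 <= #|degree_one_part e|) /\
     location_domination_number H = hypergraph_order H - packing_number H).
Proof.
split=> [H _ _ _|]; first exact: location_domination_bound.
exists one_edge; split; last split; first split.
- move=> u v; exists [set: bool], [::]; rewrite /= !inE; split=> //.
  by move=> e; rewrite !inE.
- by move=> e f /set1P-> /set1P->; rewrite eqxx.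
- by move=> e f /set1P-> /set1P->; rewrite eqxx.
- by rewrite cards1.
- exact: one_edge_degree_one_part.
apply/eqP; rewrite eqn_leq location_domination_bound /=; last first.
  exact: one_edge_degree_one_part.
apply: leq_trans (location_domination_number_gt0 one_edge true).
rewrite /hypergraph_order card_bool leq_subLR addn1 ltnS.
exact: one_edge_packing_number_gt0.
Qed.
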